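(* Consider the fully discrete BDF2 ensemble scheme described in the context, with homogeneous Dirichlet boundary conditions and with forcing terms equal to zero, i.e. $\boldsymbol f_{j,h}^{n+1}=0$ and $\nabla\times\boldsymbol g_{j,h}^{n+1}=0$ for all $j$ and $n$. Suppose that the approximations $R_{j,h}^{*,1/2}$ of $R_j(t)$ at time step $\frac12$ are positive. Then the scheme is unconditionally stable with respect to the modified energy $\mathcal F(R_j)$: for every time step $\Delta t>0$ (with no restriction relating $\Delta t$ to $h$ or to the other parameters), every $j\in\{1,\dots,J\}$ and every $n\ge0$, any solution of the scheme satisfies $$0<\mathcal F(R_{j,h}^{*,n+3/2})\le\mathcal F(R_{j,h}^{*,n+1/2}).$$
   Context: Setting. $\Omega\subset\mathbb R^d$ ($d=2,3$) is a bounded domain with boundary $\Gamma$; $(\cdot,\cdot)$ and $\|\cdot\|$ are the $L^2(\Omega)$ inner product and norm. $X=H_0^1(\Omega)^d$, $Q=L_0^2(\Omega)$ (mean-zero $L^2$ functions), and $X_h\subset X$, $Q_h\subset Q$ are conforming finite element spaces with mesh size $h$ satisfying the discrete inf-sup condition. Let $b^*(u,v,w)=\frac12(u\cdot\nabla v,w)-\frac12(u\cdot\nabla w,v)$. For $j=1,\dots,J$, let $\nu_j>0$ (kinematic viscosity) and $\gamma_j>0$ (magnetic resistivity) be constants, and set $\bar\nu=\frac1J\sum_{j}\nu_j$, $\bar\gamma=\frac1J\sum_j\gamma_j$, $\nu_j'=\nu_j-\bar\nu$, $\gamma_j'=\gamma_j-\bar\gamma$. The constant $s>0$ is the coupling number,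 $\alpha,\alpha_M\ge 0$ are regularization constants, and $\Delta t>0$. Energy and auxiliary variable. $E(\boldsymbol u,\boldsymbol B)=\frac12\|\boldsymbol u\|^2+\frac s2\|\boldsymbol B\|^2+C_0$ with $C_0>0$ a fixed constant. $\mathcal F$ is a one-to-one increasing differentiable function with inverse $\mathcal G=\mathcal F^{-1}$, both defined at least on $(0,\infty)$, with $\mathcal F(\chi)>0$ and $\mathcal G(\chi)>0$ for all $\chi>0$. The continuous scalar variable is $R_j(t)=\mathcal G(E(\boldsymbol u_j(t),\boldsymbol B_j(t)))$. Its discrete values satisfy $R_{j,h}^{*,n+3/2}=\frac32R_{j,h}^{n+1}-\frac12R_{j,h}^n$ for $n\ge0$, and $R_{j,h}^{*,1/2}$ is the given starting approximation of $R_j$ at time $\frac12\Delta t$. Notation. For a sequence $v^n$: $\tilde v^{n+1}=2v^n-v^{n-1}$. The values at indices $\le 0$ needed to start the scheme are given elements of the discrete spaces. Scheme. Given the previous values, for each $j$ find $\boldsymbol u_{j,h}^{n+1},\boldsymbol B_{j,h}^{n+1}\in X_h$, $p_{j,h}^{n+1},\lambda_{j,h}^{n+1}\in Q_h$ and a scalar $R_{j,h}^{n+1}$ such that for all $\boldsymbol v_h,\boldsymbol\chi_h\in X_h$, $l_h,\psi_h\in Q_h$ (writing $\tilde{\boldsymbol u}=\tilde{\boldsymbol u}_{j,h}^{n+1}$, $\tilde{\boldsymbol B}=\tilde{\boldsymbol B}_{j,h}^{n+1}$, $D\boldsymbol u=3\boldsymbol u_{j,h}^{n+1}-4\boldsymbol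 u_{j,h}^n+\boldsymbol u_{j,h}^{n-1}$, $D\boldsymbol B=3\boldsymbol B_{j,h}^{n+1}-4\boldsymbol B_{j,h}^n+\boldsymbol B_{j,h}^{n-1}$): (1) $\left(\frac{D\boldsymbol u}{2\Delta t},\boldsymbol v_h\right)=-\xi_j b^*(\tilde{\boldsymbol u},\tilde{\boldsymbol u},\boldsymbol v_h)+s\xi_j b^*(\tilde{\boldsymbol B},\tilde{\boldsymbol B},\boldsymbol v_h)-\bar\nu(\nabla\boldsymbol u_{j,h}^{n+1},\nabla\boldsymbol v_h)-\nu_j'(\nabla\tilde{\boldsymbol u},\nabla\boldsymbol v_h)+(p_{j,h}^{n+1},\nabla\cdot\boldsymbol v_h)-\alpha h(\nabla D\boldsymbol u,\nabla\boldsymbol v_h)+(\boldsymbol f_{j,h}^{n+1},\boldsymbol v_h)$, and $(\nabla\cdot\boldsymbol u_{j,h}^{n+1},l_h)=0$; (2) $\left(\frac{D\boldsymbol B}{2\Delta t},\boldsymbol\chi_h\right)=\xi_j b^*(\tilde{\boldsymbol B},\tilde{\boldsymbol u},\boldsymbol\chi_h)-\xi_j b^*(\tilde{\boldsymbol u},\tilde{\boldsymbol B},\boldsymbol\chi_h)-\bar\gamma(\nabla\boldsymbol B_{j,h}^{n+1},\nabla\boldsymbol\chi_h)-\gamma_j'(\nabla\tilde{\boldsymbol B},\nabla\boldsymbol\chi_h)+(\lambda_{j,h}^{n+1},\nabla\cdot\boldsymbol\chi_h)-\alpha_Mh(\nabla D\boldsymbol B,\nabla\boldsymbol\chi_h)+(\nabla\times\boldsymbol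 g_{j,h}^{n+1},\boldsymbol\chi_h)$, and $(\nabla\cdot\boldsymbol B_{j,h}^{n+1},\psi_h)=0$; (3) $\xi_j=\dfrac{\mathcal F(R_{j,h}^{*,n+3/2})}{E(\bar{\boldsymbol u}_{j,h}^{n+3/2},\bar{\boldsymbol B}_{j,h}^{n+3/2})}$; (4) $\dfrac{\mathcal F(R_{j,h}^{*,n+3/2})-\mathcal F(R_{j,h}^{*,n+1/2})}{\Delta t}=\left(\frac{D\boldsymbol u}{2\Delta t},\boldsymbol u_{j,h}^{n+1}\right)+s\left(\frac{D\boldsymbol B}{2\Delta t},\boldsymbol B_{j,h}^{n+1}\right)$ $+\xi_j b^*(\tilde{\boldsymbol u},\tilde{\boldsymbol u},\boldsymbol u_{j,h}^{n+1})-s\xi_j b^*(\tilde{\boldsymbol B},\tilde{\boldsymbol B},\boldsymbol u_{j,h}^{n+1})+\bar\nu\|\nabla\boldsymbol u_{j,h}^{n+1}\|^2+\nu_j'(\nabla\tilde{\boldsymbol u},\nabla\boldsymbol u_{j,h}^{n+1})-(p_{j,h}^{n+1},\nabla\cdot\boldsymbol u_{j,h}^{n+1})+\alpha h(\nabla D\boldsymbol u,\nabla\boldsymbol u_{j,h}^{n+1})-(\boldsymbol f_{j,h}^{n+1},\boldsymbol u_{j,h}^{n+1})$ $-s\xi_j b^*(\tilde{\boldsymbol B},\tilde{\boldsymbol u},\boldsymbol B_{j,h}^{n+1})+s\xi_j b^*(\tilde{\boldsymbol u},\tilde{\boldsymbol B},\boldsymbol B_{j,h}^{n+1})+s\bar\gamma\|\nabla\boldsymbol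 B_{j,h}^{n+1}\|^2+s\gamma_j'(\nabla\tilde{\boldsymbol B},\nabla\boldsymbol B_{j,h}^{n+1})-s(\lambda_{j,h}^{n+1},\nabla\cdot\boldsymbol B_{j,h}^{n+1})+s\alpha_Mh(\nabla D\boldsymbol B,\nabla\boldsymbol B_{j,h}^{n+1})-s(\nabla\times\boldsymbol g_{j,h}^{n+1},\boldsymbol B_{j,h}^{n+1})$ $+\xi_j\left[-\int_\Omega(\nu_j|\nabla\bar{\boldsymbol u}_{j,h}^{n+1}|^2+s\gamma_j|\nabla\bar{\boldsymbol B}_{j,h}^{n+1}|^2)\,d\Omega+S_0\right]+(1-\xi_j)|S_0|$, where $S_0=\int_\Omega\boldsymbol f_{j,h}^{n+1}\cdot\bar{\boldsymbol u}_{j,h}^{n+1}\,d\Omega+\int_\Omega s(\nabla\times\boldsymbol g_{j,h}^{n+1})\cdot\bar{\boldsymbol B}_{j,h}^{n+1}\,d\Omega$ (the additional boundary integral present for general boundary data vanishes for homogeneous Dirichlet conditions). Here $\bar{\boldsymbol u}_{j,h}^{n+1},\bar{\boldsymbol B}_{j,h}^{n+1}\in X_h$ are the second-order approximations obtained by writing the solution of (1)–(2) as $\boldsymbol u_{j,h}^{n+1}=\hat{\boldsymbol u}+\xi_j\breve{\boldsymbol u}$, $\boldsymbol B_{j,h}^{n+1}=\hat{\boldsymbol B}+\xi_j\breve{\boldsymbol B}$ with $\hat{\ },\breve{\ }$ independent of $\xi_j$, and setting $\bar{\boldsymbol u}_{j,h}^{n+1}=\hat{\boldsymbol u}+\breve{\boldsymbol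 u}$, $\bar{\boldsymbol B}_{j,h}^{n+1}=\hat{\boldsymbol B}+\breve{\boldsymbol B}$ (i.e. the solution of (1)–(2) with $\xi_j$ replaced by $1$); and $\bar{\boldsymbol u}_{j,h}^{n+3/2}=\frac32\bar{\boldsymbol u}_{j,h}^{n+1}-\frac12\boldsymbol u_{j,h}^n$, $\bar{\boldsymbol B}_{j,h}^{n+3/2}=\frac32\bar{\boldsymbol B}_{j,h}^{n+1}-\frac12\boldsymbol B_{j,h}^n$. *)

(* Defs.v *)
From HB Require Import structures.
From mathcomp Require Export all_boot all_order all_algebra.
From mathcomp Require Export all_classical all_reals all_analysis.
Export Order.TTheory GRing.Theory Num.Theory.
Export numFieldNormedType.Exports.

Set Implicit Arguments.
Unset Strict Implicit.
Unset Printing Implicit Defensive.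

Local Open Scope classical_set_scope.
Local Open Scope ring_scope.

Section row_measurable.
Context {d} {T : measurableType d} (n : nat).

Let coor (i : 'I_n) (x : 'rV[T]_n) : T := x ord0 i.

Let row_set0 : g_sigma_preimage coor set0.
Proof. exact: sigma_algebra0. Qed.

Let row_setC A : g_sigma_preimage coor A -> g_sigma_preimage coor (~` A).
Proof. exact: sigma_algebraC. Qed.

Let row_bigcup (F : _^nat) : (forall i, g_sigma_preimage coor (F i)) ->
  g_sigma_preimage coor (\bigcup_i (F i)).
Proof. exact: sigma_algebra_bigcup. Qed.

(* The σ-algebra generated by the coordinates, i.e. the Borel σ-algebra when
   [T] is the real line. *)
HB.instance Definition _ := @isMeasurable.Build (measure_tuple_display d)
  'rV[T]_n (g_sigma_preimage coor) row_set0 row_setC row_bigcup.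

End row_measurable.

Definition row_of_tuple (T : Type) n (t : n.-tuple T) : 'rV[T]_n :=
  \row_i tnth t i.

Lemma measurable_row_of_tuple d (T : measurableType d) n :
  measurable_fun [set: n.-tuple T] (@row_of_tuple T n).
Proof.
move=> _ Y mY; rewrite setTI.
suff -> : @measurable _ (n.-tuple T) =
    preimage_set_system [set: n.-tuple T] (@row_of_tuple T n)
      (@measurable _ 'rV[T]_n) by exists Y => //; rewrite setTI.
transitivity (g_sigma_preimage (fun (i : 'I_n) (t : n.-tuple T) =>
    @row_of_tuple T n t ord0 i)); last exact: g_sigma_preimage_comp.
congr g_sigma_preimage; apply/funext => i; apply/funext => t /=.
by rewrite mxE.
Qed.

Section lebesgue_row.
Local Open Scope ereal_scope.
Context {R : realType}.
Notation RT := (measurableTypeR R).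

Definition tuple_cons n (p : RT * n.-tuple RT) : n.+1.-tuple RT :=
  [tuple of p.1 :: p.2].

Lemma measurable_tuple_cons n :
  measurable_fun [set: RT * n.-tuple RT] (@tuple_cons n).
Proof. exact: measurable_cons. Qed.

Section cons_measure.
Context n (m : {sigma_finite_measure set (n.-tuple RT) -> \bar R}).
Let mcons := @measurable_tuple_cons n.

Definition cons_measure : set (n.+1.-tuple RT) -> \bar R :=
  pushforward (@lebesgue_measure R \x m) (@tuple_cons n).

Let cons_measure0 : cons_measure set0 = 0.
Proof. exact: measure0. Qed.

Let cons_measure_ge0 A : 0 <= cons_measure A.
Proof. exact: measure_ge0. Qed.

Let cons_measure_sigma_additive : semi_sigma_additive cons_measure.
Proof. exact: measure_semi_sigma_additive. Qed.

HB.instance Definition _ := isMeasure.Build _ _ _ cons_measure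
  cons_measure0 cons_measure_ge0 cons_measure_sigma_additive.

Let cons_measure_sigma_finite : sigma_finite setT cons_measure.
Proof.
have [F FT Foo] : sigma_finite setT (@lebesgue_measure R \x m).
  have /sigma_finiteP[F [TF ndF Foo]] := sigma_finiteT (@lebesgue_measure R).
  have /sigma_finiteP[G [TG ndG Goo]] := sigma_finiteT m.
  exists (fun n => F n `*` G n).
    rewrite -setXTT TF TG predeqE => -[x y]; split.
      move=> [/= [i _ Fx] [k _ Gy]]; exists (maxn i k) => //; split.
      - by move: x Fx; exact/subsetPset/ndF/leq_maxl.
      - by move: y Gy; exact/subsetPset/ndG/leq_maxr.
    by move=> [i _ []/= ? ?]; split; exists i.
  move=> k; have [? ?] := Foo k; have [? ?] := Goo k.
  split; first exact: measurableX.
  by rewrite product_measure1E// lte_mul_pinfty// ge0_fin_numE.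
pose g (t : n.+1.-tuple RT) : RT * n.-tuple RT :=
  (thead t, [tuple of behead t]).
have gK : cancel (@tuple_cons n) g.
  by case=> x t; congr pair; apply/val_inj.
have mg : measurable_fun [set: n.+1.-tuple RT] g.
  apply/measurable_fun_pair; first exact: measurable_tnth.
  exact: measurable_behead.
exists (fun i => g @^-1` F i).
  by rewrite -preimage_bigcup -FT preimage_setT.
move=> i; have [mF Fi] := Foo i; split.
  by rewrite -[X in measurable X]setTI; exact: mg.
rewrite /cons_measure /pushforward -comp_preimage.
by rewrite (_ : g \o _ = id)//; apply/funext => p /=; exact: gK.
Qed.

HB.instance Definition _ := Measure_isSigmaFinite.Build _ _ _ cons_measure
  cons_measure_sigma_finite.

End cons_measure.

(* Lebesgue measure on the [n]-fold product of the real line, as an iterated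
   product measure. *)
Fixpoint lebesgue_tuple n : {sigma_finite_measure set (n.-tuple RT) -> \bar R} :=
  match n with
  | 0 => \d_([tuple] : 0.-tuple RT)
  | m.+1 => cons_measure (lebesgue_tuple m)
  end.

Definition lebesgue_row n : set 'rV[R]_n -> \bar R :=
  pushforward (lebesgue_tuple n) (@row_of_tuple RT n : n.-tuple RT -> 'rV[R]_n).

Section lebesgue_row_measure.
Context (n : nat).
Let mrow : measurable_fun [set: n.-tuple RT]
  (@row_of_tuple RT n : n.-tuple RT -> 'rV[R]_n).
Proof. exact: (@measurable_row_of_tuple _ RT n). Qed.

Let lebesgue_row0 : @lebesgue_row n set0 = 0.
Proof. exact: (measure0 _). Qed.

Let lebesgue_row_ge0 (A : set 'rV[R]_n) : 0 <= lebesgue_row A.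
Proof. exact: measure_ge0. Qed.

Let lebesgue_row_sigma_additive : semi_sigma_additive (@lebesgue_row n).
Proof. exact: measure_semi_sigma_additive. Qed.

HB.instance Definition _ := isMeasure.Build _ _ _ (@lebesgue_row n)
  lebesgue_row0 lebesgue_row_ge0 lebesgue_row_sigma_additive.

End lebesgue_row_measure.

End lebesgue_row.

Arguments lebesgue_row {R} n.

Lemma lebesgue_tuple_box (R : realType) n
    (A : 'I_n -> set (measurableTypeR R)) : (forall i, measurable (A i)) ->
  lebesgue_tuple n [set t | forall i, A i (tnth t i)] =
  (\prod_(i < n) lebesgue_measure (A i))%E.
Proof.
elim: n A => [|n IHn] A mA.
  by rewrite big_ord0 /= diracE mem_set//= => -[].
rewrite big_ord_recl -IHn// -product_measure1E//.
- rewrite /= /cons_measure /pushforward; congr product_measure1.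
  apply/seteqP; split => -[x t] /= => [At|[A0 At] i].
    by split => [|i]; [exact: (At ord0)|move: (At (lift ord0 i)); rewrite tnthS].
  by case: (unliftP ord0 i) => [k ->|-> //]; rewrite tnthS; exact: At.
- rewrite (_ : [set t | _] = \big[setI/setT]_(i < n)
      ((fun t => tnth t i) @^-1` A (lift ord0 i))).
    apply: bigsetI_measurable => i _; rewrite -[X in measurable X]setTI.
    exact: measurable_tnth.
  rewrite -bigcap_seq; apply/seteqP; split => t /= At i; first by move=> _.
  by apply: At; rewrite /= mem_index_enum.
Qed.

Lemma lebesgue_row_box (R : realType) n (A : 'I_n -> set R) :
  (forall i, measurable (A i)) ->
  lebesgue_row n [set x | forall i, A i (x ord0 i)] =
  (\prod_(i < n) lebesgue_measure (A i : set (measurableTypeR R)))%E.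
Proof.
move=> mA; rewrite -lebesgue_tuple_box// /lebesgue_row /pushforward.
congr (lebesgue_tuple n _); apply/seteqP; split => t /= At i.
  by have := At i; rewrite mxE.
by rewrite mxE; exact: At.
Qed.

(* Elements of [L^2] and of the Sobolev spaces are represented by functions on
   the whole of [R^d], of which only the values on [Om] matter. *)

Section function_spaces.
Context {R : realType} {d : nat} (Om : set 'rV[R]_d).

Notation E := 'rV[R]_d.
Notation mu := (@lebesgue_row R d).

Definition L2 (f : E -> R) :=
  measurable_fun Om f /\ mu.-integrable Om (fun x => (f x ^+ 2)%:E).

Definition L20 (q : E -> R) := L2 q /\ \int[mu]_(x in Om) q x = 0.

Definition partial (i : 'I_d) (f : E -> R) : E -> R :=
  fun x => 'D_(delta_mx ord0 i) f x.

Definition smooth (f : E -> R) := forall s : seq 'I_d,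
  continuous (foldr partial f s) /\
  forall i x, derivable (foldr partial f s) x (delta_mx ord0 i).

Definition test_fun (phi : E -> R) :=
  [/\ smooth phi, compact (closure [set x | phi x != 0])
    & closure [set x | phi x != 0] `<=` Om].

Definition is_wpartial (i : 'I_d) (u g : E -> R) :=
  L2 g /\ forall phi, test_fun phi ->
    \int[mu]_(x in Om) (u x * partial i phi x) =
    - \int[mu]_(x in Om) (g x * phi x).

(* The weak derivative is unique only up to a null set; this is a fixed
   representative (and [0] when there is none in [L^2]). *)
Definition wpartial (i : 'I_d) (u : E -> R) : E -> R :=
  xget (fun=> 0) [set g | is_wpartial i u g].

Definition H1 (u : E -> R) :=
  L2 u /\ forall i, exists g, is_wpartial i u g.

Definition H1norm (u : E -> R) : R :=
  Num.sqrt (\int[mu]_(x in Om) (u x ^+ 2) +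
            \sum_(i < d) \int[mu]_(x in Om) (wpartial i u x ^+ 2)).

Definition H10 (u : E -> R) := H1 u /\
  forall e : R, 0 < e -> exists2 phi, test_fun phi & H1norm (u - phi) < e.

Definition vcomp n (u : E -> 'rV[R]_n) (k : 'I_n) : E -> R :=
  fun x => u x ord0 k.

Definition L2v n (u : E -> 'rV[R]_n) := forall k, L2 (vcomp u k).

Definition H10v (u : E -> 'rV[R]_d) := forall k, H10 (vcomp u k).

Definition wgrad (u : E -> 'rV[R]_d) : E -> 'M[R]_d :=
  fun x => \matrix_(k, i) wpartial i (vcomp u k) x.

Definition wdiv (u : E -> 'rV[R]_d) : E -> R := fun x => \tr (wgrad u x).

(* For [d < 3], a field [R^d -> R^3] is understood as a field on [R^3] that does
   not depend on the missing variables; the indices of the components are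
   taken modulo 3. *)
Definition partial3 (a : 'I_3) (f : E -> R) : E -> R :=
  oapp (fun i => partial i f) (fun=> 0) (insub (a : nat)).

Definition curl (v : E -> 'rV[R]_3) : E -> 'rV[R]_3 := fun x =>
  \row_a (partial3 (a + 1) (vcomp v (a + 2%:R)) x -
          partial3 (a + 2%:R) (vcomp v (a + 1)) x).

Definition is_wcurl (g c : E -> 'rV[R]_3) :=
  L2v c /\ forall phi : E -> 'rV[R]_3, (forall a, test_fun (vcomp phi a)) ->
    \int[mu]_(x in Om) (\sum_a g x ord0 a * curl phi x ord0 a) =
    \int[mu]_(x in Om) (\sum_a c x ord0 a * phi x ord0 a).

Definition Hcurl (g : E -> 'rV[R]_3) := L2v g /\ exists c, is_wcurl g c.

(* The first [d] components of the weak curl: for [d = 2] and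
   [g = (0, 0, psi)] this is the two-dimensional curl [(d_2 psi, - d_1 psi)] of
   the scalar [psi]. *)
Definition wcurl (g : E -> 'rV[R]_3) : E -> 'rV[R]_d := fun x =>
  \row_(i < d) xget (fun=> 0) [set c | is_wcurl g c] x ord0 (inord i).

Definition mdot m n (A B : 'M[R]_(m, n)) : R := \sum_i \sum_j A i j * B i j.

Definition ips (p q : E -> R) : R := \int[mu]_(x in Om) (p x * q x).

Definition ip m n (f g : E -> 'M[R]_(m, n)) : R :=
  \int[mu]_(x in Om) mdot (f x) (g x).

Definition norms (q : E -> R) : R := Num.sqrt (ips q q).

Definition norm m n (f : E -> 'M[R]_(m, n)) : R := Num.sqrt (ip f f).

Definition adv (u v : E -> 'rV[R]_d) : E -> 'rV[R]_d :=
  fun x => u x *m (wgrad v x)^T.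

Definition bstar (u v w : E -> 'rV[R]_d) : R :=
  2^-1 * ip (adv u v) w - 2^-1 * ip (adv u w) v.

Definition edist (x y : E) : R := Num.sqrt (mdot (x - y) (x - y)).

Definition is_mesh (N : nat) (K : 'I_N -> set E) (h : R) :=
  [/\ forall a, [/\ closed (K a), (K a)° !=set0 & connected (K a)°],
      \bigcup_a K a = closure Om,
      forall a b, a != b -> (K a)° `&` (K b)° = set0
    & h = sup [set r | exists a x y, [/\ K a x, K a y & r = edist x y]]].

(* The span of the [phi l] is the space of local shape functions of the cell
   [K c]; no particular choice (polynomials, mapped polynomials, bubbles) is
   imposed. *)
Definition fe_space (N : nat) (K : 'I_N -> set E) (W : lmodType R)
    (S : set (E -> W)) :=
  [/\ S (fun=> 0),
      forall (a : R) u v, S u -> S v -> S (fun x => a *: u x + v x)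
    & forall c, exists m (phi : 'I_m -> E -> W), forall v, S v ->
        exists a : 'I_m -> R,
          {ae mu, forall x, K c x -> v x = \sum_(l < m) a l *: phi l x}].

Definition inf_sup (Xh : set (E -> 'rV[R]_d)) (Qh : set (E -> R)) (beta : R) :=
  (beta%:E <= ereal_inf
    [set ereal_sup [set (ips q (wdiv v) / (norm (wgrad v) * norms q))%:E
                    | v in Xh `&` [set v | norm (wgrad v) != 0%R]]
     | q in Qh `&` [set q | norms q != 0%R]])%E.

End function_spaces.

Definition mean (R : realType) J (a : 'I_J -> R) : R := J%:R^-1 * \sum_j a j.

(* [Rv n] is the value at time level [n], [Rhalf] the given value at level 1/2,
   and [Rstar Rhalf Rv n] the extrapolated value at level [n + 1/2]. *)
Definition Rstar (R : realType) (Rhalf : R) (Rv : nat -> R) (n : nat) : R :=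
  if n is m.+1 then 3 / 2 * Rv m.+1 - 1 / 2 * Rv m else Rhalf.

Section scheme.
Context {R : realType} {d : nat}.
Notation E := 'rV[R]_d.
Notation vfield := ('rV[R]_d -> 'rV[R]_d).
Notation sfield := ('rV[R]_d -> R).
Context (Om : set E) (Xh : set vfield) (Qh : set sfield).
Context (J : nat) (nu gam : 'I_J -> R) (s al alM h dt C0 : R).

Notation "( u , v )_Om" := (ip Om u v) (at level 0, format "( u ,  v )_Om").
Notation grad := (wgrad Om).
Notation div := (wdiv Om).
Notation b := (bstar Om).
Notation mu := (@lebesgue_row R d).

Definition energy (u B : vfield) : R :=
  1 / 2 * norm Om u ^+ 2 + s / 2 * norm Om B ^+ 2 + C0.

(* [w2], [w1], [w0] are the values at levels [n + 1], [n], [n - 1]. *)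
Definition bdf (w2 w1 w0 : vfield) : vfield :=
  fun x => 3 *: w2 x - 4 *: w1 x + w0 x.
Definition extrap (w1 w0 : vfield) : vfield := fun x => 2 *: w1 x - w0 x.
Definition sc (a : R) (w : vfield) : vfield := fun x => a *: w x.

(* The discrete momentum and induction equations of member [j], for a given value
   of [xi]; [cg] is the curl of the magnetic source. *)
Definition field_eqs (j : 'I_J) (xi : R) (u1 u0 B1 B0 f cg : vfield)
    (u2 B2 : vfield) (p lam : sfield) : Prop :=
  let ut := extrap u1 u0 in
  let Bt := extrap B1 B0 in
  let Du := bdf u2 u1 u0 in
  let DB := bdf B2 B1 B0 in
  [/\ [/\ Xh u2, Xh B2, Qh p & Qh lam],
      forall v, Xh v ->
        (sc (2 * dt)^-1 Du, v)_Om =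
          - (xi * b ut ut v) + s * xi * b Bt Bt v
          - mean nu * (grad u2, grad v)_Om
          - (nu j - mean nu) * (grad ut, grad v)_Om
          + ips Om p (div v)
          - al * h * (grad Du, grad v)_Om
          + (f, v)_Om,
      forall l, Qh l -> ips Om (div u2) l = 0,
      forall chi, Xh chi ->
        (sc (2 * dt)^-1 DB, chi)_Om =
          xi * b Bt ut chi - xi * b ut Bt chi
          - mean gam * (grad B2, grad chi)_Om
          - (gam j - mean gam) * (grad Bt, grad chi)_Om
          + ips Om lam (div chi)
          - alM * h * (grad DB, grad chi)_Om
          + (cg, chi)_Om
    & forall psi, Qh psi -> ips Om (div B2) psi = 0].

(* The solution of [field_eqs] is affine in [xi]; the second-order
   approximations [ub], [Bb] at level [n + 1] are its values at [xi = 1]. *)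
Definition bar_fields (j : 'I_J) (xi : R) (u1 u0 B1 B0 f cg : vfield)
    (u2 B2 ub Bb : vfield) : Prop :=
  exists uhat ubrv Bhat Bbrv : vfield,
    [/\ [/\ Xh uhat, Xh ubrv, Xh Bhat & Xh Bbrv],
        forall z : R, exists p lam,
          field_eqs j z u1 u0 B1 B0 f cg
            (fun x => uhat x + z *: ubrv x) (fun x => Bhat x + z *: Bbrv x)
            p lam,
        {ae mu, forall x, Om x -> u2 x = uhat x + xi *: ubrv x},
        {ae mu, forall x, Om x -> B2 x = Bhat x + xi *: Bbrv x}
      & ub = (fun x => uhat x + ubrv x) /\ Bb = (fun x => Bhat x + Bbrv x)].

Definition at_three_halves (wb w1 : vfield) : vfield :=
  fun x => (3 / 2) *: wb x - (1 / 2) *: w1 x.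

(* [F2] and [F1] are the values of the transformed auxiliary variable at levels
   [n + 3/2] and [n + 1/2]. *)
Definition aux_eq (j : 'I_J) (xi F2 F1 : R) (u1 u0 B1 B0 f cg : vfield)
    (u2 B2 ub Bb : vfield) (p lam : sfield) : Prop :=
  let ut := extrap u1 u0 in
  let Bt := extrap B1 B0 in
  let Du := bdf u2 u1 u0 in
  let DB := bdf B2 B1 B0 in
  let S0 := \int[mu]_(x in Om) mdot (f x) (ub x) +
            \int[mu]_(x in Om) (s * mdot (cg x) (Bb x)) in
  (F2 - F1) / dt =
    (sc (2 * dt)^-1 Du, u2)_Om + s * (sc (2 * dt)^-1 DB, B2)_Om
    + xi * b ut ut u2 - s * xi * b Bt Bt u2
    + mean nu * norm Om (grad u2) ^+ 2
    + (nu j - mean nu) * (grad ut, grad u2)_Om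
    - ips Om p (div u2)
    + al * h * (grad Du, grad u2)_Om
    - (f, u2)_Om
    - s * xi * b Bt ut B2 + s * xi * b ut Bt B2
    + s * mean gam * norm Om (grad B2) ^+ 2
    + s * (gam j - mean gam) * (grad Bt, grad B2)_Om
    - s * ips Om lam (div B2)
    + s * alM * h * (grad DB, grad B2)_Om
    - s * (cg, B2)_Om
    + xi * (- \int[mu]_(x in Om)
                (nu j * mdot (grad ub x) (grad ub x)
                 + s * gam j * mdot (grad Bb x) (grad Bb x)) + S0)
    + (1 - xi) * `|S0|.

(* Velocities and magnetic fields are indexed by [int], as the scheme starts
   from the levels [-1] and [0]; the other unknowns of step [n] carry their
   level [n + 1] ([p], [lam], [ub], [Bb], [f], [g]) or the step [n] ([xi]).
   [DF] is the domain of [F]. *)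
Definition scheme_solution (F : R -> R) (DF : set R)
    (f : 'I_J -> nat -> vfield) (g : 'I_J -> nat -> E -> 'rV[R]_3)
    (Rhalf : 'I_J -> R) (u B : 'I_J -> int -> vfield)
    (p lam : 'I_J -> nat -> sfield) (Rv : 'I_J -> nat -> R)
    (xi : 'I_J -> nat -> R) (ub Bb : 'I_J -> nat -> vfield) : Prop :=
  forall j,
  [/\ [/\ Xh (u j (- 1)), Xh (u j 0), Xh (B j (- 1)) & Xh (B j 0)],
      forall n, DF (Rstar (Rhalf j) (Rv j) n)
    & forall n : nat,
        let u2 := u j (n%:Z + 1) in
        let u1 := u j n%:Z in
        let u0 := u j (n%:Z - 1) in
        let B2 := B j (n%:Z + 1) in
        let B1 := B j n%:Z in
        let B0 := B j (n%:Z - 1) in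
        let f2 := f j n.+1 in
        let cg2 := wcurl Om (g j n.+1) in
        let F2 := F (Rstar (Rhalf j) (Rv j) n.+1) in
        let F1 := F (Rstar (Rhalf j) (Rv j) n) in
        [/\ field_eqs j (xi j n) u1 u0 B1 B0 f2 cg2 u2 B2
              (p j n.+1) (lam j n.+1),
            bar_fields j (xi j n) u1 u0 B1 B0 f2 cg2 u2 B2
              (ub j n.+1) (Bb j n.+1),
            xi j n = F2 / energy (at_three_halves (ub j n.+1) u1)
                                 (at_three_halves (Bb j n.+1) B1)
          & aux_eq j (xi j n) F2 F1 u1 u0 B1 B0 f2 cg2 u2 B2
              (ub j n.+1) (Bb j n.+1) (p j n.+1) (lam j n.+1)]].

End scheme.

(* Main.v *)
From mathcomp Require Import ring.
Require Import Defs.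

Set Implicit Arguments.
Unset Strict Implicit.
Unset Printing Implicit Defensive.

(** Test the momentum equation with the new velocity and the induction equation
    with [s] times the new magnetic field.  The right-hand side of the scalar
    equation is built so that all the terms of these two identities (convection,
    viscosity, pressure, regularization, forcing) cancel in it.  What is left is
    the work [S0] of the sources and the viscous and resistive dissipation
    [D >= 0] of the second-order approximations.  Without forcing [S0 = 0]
    ([source_work_eq0]), and the scalar equation becomes
    [(F2 - F1) / dt = - (xi * D)] ([aux_eq_unforced]).  As [xi = F2 / E] with
    [E >= C0 > 0], this is linear in [F2]: [F2 * (1 + dt * D / E) = F1].  So [F2]
    is [F1] divided by a number which is at least 1: it has the sign of [F1], and
    it does not exceed [F1] when that is positive ([implicit_decay]).  Positivity
    thus propagates by induction from the starting value, whatever the size of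
    [dt]. *)

Local Open Scope classical_set_scope.
Local Open Scope ring_scope.

Section ae_zero.
Local Open Scope ereal_scope.
Context d (T : measurableType d) (R : realType).
Variable mu : {measure set T -> \bar R}.
Import HBNNSimple.

(** The integral is the supremum of the integrals of the simple functions below
    [f].  Each of these is measurable, even when [f] is not, and vanishes off the
    null set where [f] may be nonzero, so it has integral zero. *)
Lemma ge0_integralT_ae_eq0 (f : T -> \bar R) : (forall x, 0 <= f x) ->
  {ae mu, forall x, f x = 0} -> \int[mu]_x f x = 0.
Proof.
move=> f0 [N [mN muN fN]]; apply/eqP; rewrite eq_le integral_ge0// andbT.
rewrite ge0_integralTE//; apply: ge_ereal_sup => /= _ [k /= kf <-].
rewrite -integralT_nnsfun (ge0_negligible_integral mN)//; first last.
- by move=> x _; rewrite lee_fin; exact: fun_ge0.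
- exact/measurable_realfun.measurable_EFinP.
rewrite integral0_eq// => x [_ Nx]; apply/eqP.
rewrite eq_le [X in _ && X]lee_fin fun_ge0 andbT.
have <- : f x = 0 by apply: contrapT => fx0; exact/Nx/fN.
exact: kf.
Qed.

Lemma integral_ae_eq0 (D : set T) (f : T -> \bar R) :
  {ae mu, forall x, D x -> f x = 0} -> \int[mu]_(x in D) f x = 0.
Proof.
move=> f0; have fD0 : {ae mu, forall x, (f \_ D) x = 0}.
  apply: filterS f0 => x f0; rewrite patchE; case: ifPn => //.
  by rewrite inE => /f0.
rewrite integral_mkcond integralE !ge0_integralT_ae_eq0 ?sube0//.
  by apply: filterS fD0 => x; rewrite funenegE => ->; rewrite oppe0 maxxx.
by apply: filterS fD0 => x; rewrite funeposE => ->; rewrite maxxx.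
Qed.

End ae_zero.

Lemma Rintegral_ae_eq0 d (T : measurableType d) (R : realType)
    (mu : {measure set T -> \bar R}) (D : set T) (f : T -> R) :
  {ae mu, forall x, D x -> f x = 0} -> \int[mu]_(x in D) f x = 0.
Proof.
move=> f0; rewrite /Rintegral integral_ae_eq0//.
by apply: filterS f0 => x f0 /f0 ->.
Qed.

Section inner_products.
Context {R : realType} {d : nat} (Om : set 'rV[R]_d).
Implicit Types u B : 'rV[R]_d -> 'rV[R]_d.

Lemma mdot0l m n (A : 'M[R]_(m, n)) : mdot 0 A = 0.
Proof.
by rewrite /mdot big1// => i _; rewrite big1// => j _; rewrite mxE mul0r.
Qed.

Lemma mdotxx_ge0 m n (A : 'M[R]_(m, n)) : 0 <= mdot A A.
Proof. by do 2!apply: sumr_ge0 => ? _; rewrite -expr2 sqr_ge0. Qed.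

Lemma sqr_norm m n (f : 'rV[R]_d -> 'M[R]_(m, n)) :
  norm Om f ^+ 2 = ip Om f f.
Proof. by rewrite sqr_sqrtr// Rintegral_ge0// => x _; exact: mdotxx_ge0. Qed.

Lemma energy_gt0 (s C0 : R) u B :
  0 < s -> 0 < C0 -> 0 < energy Om s C0 u B.
Proof.
move=> s0 C00; apply: ltr_wpDl => //.
by rewrite addr_ge0// mulr_ge0 ?sqr_ge0// divr_ge0// ltW.
Qed.

End inner_products.

(** The shape taken by one step for the transformed auxiliary variable, an
    implicit Euler step of linear decay with rate [D / E]. *)
Lemma implicit_decay (R : realFieldType) (dt D E F1 F2 : R) :
  0 < dt -> 0 <= D -> 0 < E -> 0 < F1 ->
  (F2 - F1) / dt = - (F2 / E * D) -> 0 < F2 <= F1.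
Proof.
move=> dt0 D0 E0 F10; set c := dt * (D / E) => F21.
have {}F21 : F2 * (1 + c) = F1.
  have dtN0 := lt0r_neq0 dt0.
  have : F2 - F1 = - (F2 / E * D) * dt by rewrite -F21 divfK.
  by move=> F21'; rewrite -[RHS](subKr F2) F21' /c; ring.
have c1_ge1 : 1 <= 1 + c by rewrite lerDl mulr_ge0 ?divr_ge0// ltW.
have F2_gt0 : 0 < F2 by rewrite -(pmulr_lgt0 _ (lt_le_trans ltr01 c1_ge1)) F21.
by rewrite F2_gt0 -F21 ler_peMr// ltW.
Qed.

Section step.
Context {R : realType} {d : nat} (Om : set 'rV[R]_d).
Context (Xh : set ('rV[R]_d -> 'rV[R]_d)) (Qh : set ('rV[R]_d -> R)).
Context (J : nat) (nu gam : 'I_J -> R) (s al alM h dt : R) (j : 'I_J).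
Implicit Types (u B f cg ub Bb : 'rV[R]_d -> 'rV[R]_d).

Notation mu := (@lebesgue_row R d).

Definition source_work f cg ub Bb : R :=
  \int[mu]_(x in Om) mdot (f x) (ub x) +
  \int[mu]_(x in Om) (s * mdot (cg x) (Bb x)).

Definition dissipation ub Bb : R :=
  \int[mu]_(x in Om)
    (nu j * mdot (wgrad Om ub x) (wgrad Om ub x)
     + s * gam j * mdot (wgrad Om Bb x) (wgrad Om Bb x)).

Lemma source_work_eq0 f cg ub Bb :
  {ae mu, forall x, Om x -> f x = 0} -> {ae mu, forall x, Om x -> cg x = 0} ->
  source_work f cg ub Bb = 0.
Proof.
move=> f0 cg0; rewrite /source_work !Rintegral_ae_eq0 ?addr0//.
  by apply: filterS cg0 => x cg0 /cg0 ->; rewrite mdot0l mulr0.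
by apply: filterS f0 => x f0 /f0 ->; rewrite mdot0l.
Qed.

Lemma dissipation_ge0 ub Bb : 0 <= nu j -> 0 <= gam j -> 0 <= s ->
  0 <= dissipation ub Bb.
Proof.
move=> nu0 gam0 s0; apply: Rintegral_ge0 => x _.
by rewrite addr_ge0// !mulr_ge0// mdotxx_ge0.
Qed.

(** The two tested field equations account for every term of the scalar equation
    that involves the new fields; only those of the second-order approximations
    survive, and with no work done by the sources these are the dissipation. *)
Lemma aux_eq_unforced xi F2 F1 u1 u0 B1 B0 f cg u2 B2 ub Bb p lam :
  field_eqs Om Xh Qh nu gam s al alM h dt j xi u1 u0 B1 B0 f cg u2 B2 p lam ->
  aux_eq Om nu gam s al alM h dt j xi F2 F1 u1 u0 B1 B0 f cg u2 B2 ub Bb p lam ->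
  source_work f cg ub Bb = 0 -> (F2 - F1) / dt = - (xi * dissipation ub Bb).
Proof.
move=> [[Xu2 XB2 _ _] /(_ _ Xu2) momentum _ /(_ _ XB2) induction _].
rewrite /aux_eq -/(source_work f cg ub Bb) -/(dissipation ub Bb) => + work0.
rewrite work0 normr0 => ->; move: (@sqr_norm R d Om d d) momentum induction.
(* The identity is purely algebraic; with the analytic operators turned into
   variables, comparing two terms never unfolds an integral. *)
generalize (dissipation ub Bb) (bstar Om).
generalize (@norm R d Om) (@ip R d Om) (ips Om) (wgrad Om) (wdiv Om).
generalize (mean nu) (mean gam).
move=> nub gamb norm ip ips grad div D b normE -> ->.
by rewrite !normE; ring.
Qed.

End step.

Theorem theorem6 (R : realType) (d : nat) (hd : d = 2%N \/ d = 3%N)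
  (Om : set 'rV[R]_d) (Om_open : open Om) (Om_conn : connected Om)
  (Om_bnd : bounded_set Om) (Om_ne : Om !=set0)
  (N : nat) (K : 'I_N -> set 'rV[R]_d) (h : R) (mesh : is_mesh Om K h)
  (Xh : set ('rV[R]_d -> 'rV[R]_d)) (Qh : set ('rV[R]_d -> R))
  (Xh_fe : fe_space K Xh) (Qh_fe : @fe_space R d N K R^o Qh)
  (Xh_conf : Xh `<=` H10v Om) (Qh_conf : Qh `<=` L20 Om)
  (beta : R) (beta_gt0 : 0 < beta) (infsup : inf_sup Om Xh Qh beta)
  (J : nat) (nu gam : 'I_J -> R)
  (nu_gt0 : forall j, 0 < nu j) (gam_gt0 : forall j, 0 < gam j)
  (s al alM C0 : R) (s_gt0 : 0 < s) (al_ge0 : 0 <= al) (alM_ge0 : 0 <= alM)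
  (C0_gt0 : 0 < C0)
  (* the transform F, with domain DF, and its inverse G, with domain DG *)
  (F G : R -> R) (DF DG : set R)
  (DF_pos : [set x | 0 < x] `<=` DF) (DG_pos : [set x | 0 < x] `<=` DG)
  (F_img : F @` DF = DG) (F_K : forall x, DF x -> G (F x) = x)
  (F_incr : forall x y, DF x -> DF y -> x < y -> F x < F y)
  (F_diff : forall x, DF x -> derivable F x 1)
  (F_gt0 : forall x, 0 < x -> 0 < F x) (G_gt0 : forall x, 0 < x -> 0 < G x)
  (f : 'I_J -> nat -> 'rV[R]_d -> 'rV[R]_d)
  (g : 'I_J -> nat -> 'rV[R]_d -> 'rV[R]_3)
  (f_L2 : forall j n, L2v Om (f j n.+1))
  (g_curl : forall j n, Hcurl Om (g j n.+1))
  (f_eq0 : forall j n,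
    {ae @lebesgue_row R d, forall x, Om x -> f j n.+1 x = 0})
  (curlg_eq0 : forall j n,
    {ae @lebesgue_row R d, forall x, Om x -> wcurl Om (g j n.+1) x = 0})
  (Rhalf : 'I_J -> R) (Rhalf_gt0 : forall j, 0 < Rhalf j) :
  forall dt : R, 0 < dt ->
  forall (u B : 'I_J -> int -> 'rV[R]_d -> 'rV[R]_d)
    (p lam : 'I_J -> nat -> 'rV[R]_d -> R) (Rv xi : 'I_J -> nat -> R)
    (ub Bb : 'I_J -> nat -> 'rV[R]_d -> 'rV[R]_d),
  scheme_solution Om Xh Qh nu gam s al alM h dt C0 F DF f g Rhalf
    u B p lam Rv xi ub Bb ->
  forall (j : 'I_J) (n : nat),
    0 < F (Rstar (Rhalf j) (Rv j) n.+1) <= F (Rstar (Rhalf j) (Rv j) n).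
Proof.
move=> dt dt_gt0 u B p lam Rv xi ub Bb sol j n.
have [_ _ step] := sol j.
have decay k : 0 < F (Rstar (Rhalf j) (Rv j) k) ->
    0 < F (Rstar (Rhalf j) (Rv j) k.+1) <= F (Rstar (Rhalf j) (Rv j) k).
  move=> Fk_gt0; have [feqs _ xiE /(aux_eq_unforced feqs)] := step k.
  rewrite xiE => /(_ (source_work_eq0 _ _ _ (f_eq0 j k) (curlg_eq0 j k))).
  apply: implicit_decay => //; last exact: energy_gt0.
  by rewrite dissipation_ge0// ltW.
by apply/decay; elim: n => [|n /decay/andP[]//]; exact: (F_gt0 _ (Rhalf_gt0 j)).
Qed.
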